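(* A binary relation $\succsim$ on $l_\infty$ satisfies Weak order, Monotonicity, Continuity, ICRP, Convexity, ISU and IFPIS if and only if there exists a unique nonempty convex weak$^\star$-compact set $D\subseteq pa(\mathbb N)\cap\Delta$ such that $$I(x)=\min_{\mu\in D}\langle x,\mu\rangle$$ is the unique constant equivalent representing $\succsim$.
   Context: $l_\infty$: real bounded sequences indexed by $\mathbb N$; $\theta\in\mathbb R$ also a constant sequence; $x\ge y$ coordinatewise. $ba(\mathbb N)$: norm dual of $l_\infty$, pairing $\langle x,\mu\rangle$, weak$^\star$ topology. $\Delta$: finitely additive probability measures on $2^{\mathbb N}$; $pa(\mathbb N)$: $\mu\in ba(\mathbb N)$ with $\mu(\{n\})=0$ for all $n$. A finite permutation is a bijection $\sigma:\mathbb N\to\mathbb N$ fixing all but finitely many points; $d_\sigma=(d_{\sigma(0)},d_{\sigma(1)},\dots)$. Constant equivalent: $I$ with $x\sim I(x)$, $x\succsim y\iff I(x)\ge I(y)$. Weak order: complete, transitive. Monotonicity: $x\ge y\Rightarrow x\succsim y$, $1\succ0$. Continuity: for $x\succsim y\succsim z$ the sets $\{\alpha\in[0,1]:\alpha x+(1-\alpha)z\succsim y\}$, $\{\alpha:y\succsim\alpha x+(1-\alpha)z\}$ are closed. ICRP: $x\succsim y\Rightarrow x+\theta\succsim y+\theta$. Convexity: $x\succsim\theta,y\succsim\theta\Rightarrow\lambda x+(1-\lambda)y\succsim\theta$. ISU: $x\succsim y$, $\alpha\ge0\Rightarrow\alpha x\succsim\alpha y$. IFPIS: for every finite permutation $\sigma$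 and $x,d\in l_\infty$, $x+d\succsim x$ implies $x+d_\sigma\succsim x$. *)

(* Defs.v *)
From HB Require Import structures.
From mathcomp Require Import all_boot all_order all_algebra.
From mathcomp Require Import all_classical all_reals all_analysis.
Set Implicit Arguments. Unset Strict Implicit. Unset Printing Implicit Defensive.
Import Order.TTheory GRing.Theory Num.Theory numFieldNormedType.Exports.
Local Open Scope ring_scope.
Local Open Scope classical_set_scope.

Section Linf.
Variable R : realType.

Record linf := Linf { lseq :> nat -> R ;
                      lseq_bnd : exists M : R, forall n, `|lseq n| <= M }.

Lemma const_bnd (t : R) : exists M : R, forall n : nat, `|(fun _ : nat => t) n| <= M.
Proof. by exists `|t|. Qed.
Definition lconst (t : R) : linf := Linf (const_bnd t).

Lemma add_bnd (x y : linf) :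
  exists M : R, forall n, `|(fun n => x n + y n) n| <= M.
Proof.
case: (lseq_bnd x) => a Ha; case: (lseq_bnd y) => b Hb.
exists (a + b) => n /=; apply: le_trans (ler_normD _ _) _; exact: lerD.
Qed.
Definition ladd (x y : linf) : linf := Linf (add_bnd x y).

Lemma scale_bnd (c : R) (x : linf) :
  exists M : R, forall n, `|(fun n => c * x n) n| <= M.
Proof.
case: (lseq_bnd x) => a Ha; exists (`|c| * a) => n /=.
by rewrite normrM; apply: ler_wpM2l.
Qed.
Definition lscale (c : R) (x : linf) : linf := Linf (scale_bnd c x).

Lemma perm_bnd (s : nat -> nat) (x : linf) :
  exists M : R, forall n, `|(fun n => x (s n)) n| <= M.
Proof. by case: (lseq_bnd x) => a Ha; exists a => n. Qed.
Definition lperm (s : nat -> nat) (d : linf) : linf := Linf (perm_bnd s d).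

Lemma ind_bnd (A : set nat) :
  exists M : R, forall n, `|(fun n => if `[< A n >] then 1 else 0 : R) n| <= M.
Proof. by exists 1 => n /=; case: ifP; rewrite ?normr1 ?normr0. Qed.
Definition lind (A : set nat) : linf := Linf (ind_bnd A).

Definition lge (x y : linf) : Prop := forall n, y n <= x n.

Definition finite_perm (s : nat -> nat) : Prop :=
  bijective s /\ finite_set [set n | s n <> n].

Section Prefs.
Variable pref : linf -> linf -> Prop.

Definition strict (x y : linf) := pref x y /\ ~ pref y x.
Definition indiff (x y : linf) := pref x y /\ pref y x.

Definition weak_order :=
  (forall x y, pref x y \/ pref y x) /\
  (forall x y z, pref x y -> pref y z -> pref x z).

Definition monotonicity :=
  (forall x y, lge x y -> pref x y) /\ strict (lconst 1) (lconst 0).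

Definition mix (a : R) (x z : linf) : linf := ladd (lscale a x) (lscale (1 - a) z).

Definition continuity :=
  forall x y z, pref x y -> pref y z ->
    closed [set a : R | 0 <= a <= 1 /\ pref (mix a x z) y] /\
    closed [set a : R | 0 <= a <= 1 /\ pref y (mix a x z)].

Definition ICRP :=
  forall x y (t : R), pref x y -> pref (ladd x (lconst t)) (ladd y (lconst t)).

Definition convexity :=
  forall x y (t l : R), 0 <= l <= 1 ->
    pref x (lconst t) -> pref y (lconst t) -> pref (mix l x y) (lconst t).

Definition ISU :=
  forall x y (a : R), 0 <= a -> pref x y -> pref (lscale a x) (lscale a y).

Definition IFPIS :=
  forall s, finite_perm s -> forall x d : linf,
    pref (ladd x d) x -> pref (ladd x (lperm s d)) x.

Definition const_equiv (I : linf -> R) :=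
  (forall x, indiff x (lconst (I x))) /\
  (forall x y, pref x y <-> I y <= I x).

End Prefs.

(* functionals live in the product (pointwise) topology on linf -> R, which
   restricted to the dual is exactly the weak* topology *)
Definition dualT := {ptws linf -> R}.

Definition in_ba (mu : dualT) : Prop :=
  (forall x y, mu (ladd x y) = mu x + mu y) /\
  (forall c x, mu (lscale c x) = c * mu x) /\
  (exists C : R, forall (x : linf) (M : R),
      (forall n, `|x n| <= M) -> `|mu x| <= C * M).

Definition setfun (mu : dualT) (A : set nat) : R := mu (lind A).

Definition in_Delta (mu : dualT) : Prop :=
  in_ba mu /\ (forall A, 0 <= setfun mu A) /\ setfun mu setT = 1.

Definition in_pa (mu : dualT) : Prop :=
  in_ba mu /\ forall n : nat, setfun mu [set n] = 0.

Definition convex_dual (D : set dualT) : Prop :=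
  forall mu nu (l : R), D mu -> D nu -> 0 <= l <= 1 ->
    D ((fun x => l * mu x + (1 - l) * nu x) : dualT).

Definition is_min_rep (D : set dualT) (I : linf -> R) : Prop :=
  forall x, (exists2 mu, D mu & mu x = I x) /\ (forall mu, D mu -> I x <= mu x).

End Linf.

(* Main.v *)
Require Import Defs.
From HB Require Import structures.
From mathcomp Require Import all_boot all_order all_algebra.
From mathcomp Require Import all_classical all_reals all_analysis.
From mathcomp Require Import ring lra zify.
Import Order.TTheory GRing.Theory Num.Theory numFieldNormedType.Exports.
Local Open Scope ring_scope.
Local Open Scope classical_set_scope.
Set Implicit Arguments.
Unset Strict Implicit.

(** Under the axioms every [x] has a constant equivalent [I x], and [I] is
    monotone, translation equivariant and superlinear.  By Hahn-Banach, [I] is the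
    minimum of the linear functionals lying above it; these form a convex
    weak-star compact set of finitely additive probabilities.  Applied to
    [x = - e_i] and [d = e_i + I (- e_i)], which satisfy [x + d ~ x], IFPIS gives
    [I (e_j - e_i) >= 0], so such a functional gives all points the same mass,
    which can only be 0.  Uniqueness of the set holds because a compact convex set
    of linear functionals with minimum [I] contains every linear functional above
    [I], by separation in finitely many coordinates.  Conversely, a functional
    vanishing on points is invariant under finite permutations, which gives IFPIS. *)

(** * Hahn-Banach for superlinear functionals *)

Section Superlinear.
Variables (R : realType) (V : lmodType R).
Implicit Types (q f : V -> R) (x y : V).

Definition superlinear q :=
  (forall x y, q x + q y <= q (x + y)) /\
  (forall (c : R) x, 0 <= c -> q (c *: x) = c * q x).

Definition linear_functional f :=
  (forall x y, f (x + y) = f x + f y) /\ (forall (c : R) x, f (c *: x) = c * f x).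

Lemma superlinear0 q : superlinear q -> q 0 = 0.
Proof. by move=> [_ qZ]; rewrite -(scale0r 0) qZ// mul0r. Qed.

Lemma superlinear_leN q x : superlinear q -> q x <= - q (- x).
Proof.
move=> qS; have := qS.1 x (- x); rewrite subrr (superlinear0 qS); lra.
Qed.

Lemma linear_functionalN f x : linear_functional f -> f (- x) = - f x.
Proof. by move=> [_ fZ]; rewrite -scaleN1r fZ mulN1r. Qed.

(** The inequality [q x <= - q (- x)] always holds, so the hypothesis makes [q] odd; superadditivity
    at [- x] and [- y] then gives subadditivity at [x] and [y]. *)
Lemma superlinear_odd_linear q :
  superlinear q -> (forall x, - q (- x) <= q x) -> linear_functional q.
Proof.
move=> qS qN.
have qNE x : q (- x) = - q x.
  by have := superlinear_leN x qS; have := qN x; lra.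
have qD x y : q (x + y) = q x + q y.
  apply/eqP; rewrite eq_le qS.1 andbT.
  have := qS.1 (- x) (- y); rewrite -opprD !qNE; lra.
split=> // c x; have [c0|c0] := leP 0 c; first exact: qS.2.
rewrite -[c]opprK scaleNr qNE qS.2 ?mulNr//; lra.
Qed.

Section SupFamily.
Variables (T : Type) (A : set T) (F : T -> V -> R) (b : V -> R).
Hypothesis A0 : A !=set0.
Hypothesis Fb : forall i x, A i -> F i x <= b x.

Let S x := sup [set F i x | i in A].

Lemma sup_family_ge i x : A i -> F i x <= S x.
Proof.
move=> Ai; apply: ub_le_sup; last by exists i.
by exists (b x) => _ [j Aj <-]; exact: Fb.
Qed.

Lemma sup_family_le x c : (forall i, A i -> F i x <= c) -> S x <= c.
Proof.
move=> Fc; apply: ge_sup; first by case: A0 => i Ai; exists (F i x), i.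
by move=> _ [j Aj <-]; exact: Fc.
Qed.

(** The members need not be superlinear: superadditivity and homogeneity are required only up to a
    change of index. This covers both the translates of one functional and chains of functionals. *)
Lemma sup_family_superlinear :
  (forall i j x y, A i -> A j -> exists2 k, A k & F i x + F j y <= F k (x + y)) ->
  (forall i c x, A i -> 0 < c -> exists2 k, A k & c * F i x <= F k (c *: x)) ->
  (forall i, A i -> F i 0 = 0) ->
  superlinear S.
Proof.
move=> FD FZ F0; split=> [x y|c x c0].
  rewrite -lerBrDr; apply: sup_family_le => i Ai.
  rewrite lerBrDr -lerBrDl; apply: sup_family_le => j Aj; rewrite lerBrDl.
  have [k Ak le_k] := FD i j x y Ai Aj.
  exact: le_trans le_k (sup_family_ge _ Ak).
have ZS d z : 0 < d -> d * S z <= S (d *: z).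
  move=> d0; rewrite -ler_pdivlMl//; apply: sup_family_le => i Ai.
  rewrite ler_pdivlMl//; have [k Ak le_k] := FZ i d z Ai d0.
  exact: le_trans le_k (sup_family_ge _ Ak).
have S0 : S 0 = 0.
  apply/eqP; rewrite eq_le; apply/andP; split.
    by apply: sup_family_le => i /F0 ->.
  by have [i Ai] := A0; rewrite -(F0 i Ai); exact: sup_family_ge.
move: c0; rewrite le_eqVlt => /predU1P[<-|c0]; first by rewrite scale0r mul0r.
apply/eqP; rewrite eq_le ZS// andbT.
(* The missing inequality is [ZS] for the factor [c^-1] at [c *: x]. *)
have cV0 : 0 < c^-1 by rewrite invr_gt0.
have := ZS _ (c *: x) cV0.
by rewrite scalerA mulVf ?gt_eqF// scale1r ler_pdivrMl.
Qed.

End SupFamily.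

(** The supremum of [q (x + t *: a) - t * q a] over [t >= 0] works: [t = 0] gives domination of [q],
    and [t = 1] gives the bound at [- a]. *)
Lemma superlinear_refine q a : superlinear q ->
  exists q', [/\ superlinear q', forall x, q x <= q' x & - q a <= q' (- a)].
Proof.
move=> qS; have [qD qZ] := qS.
pose A := [set t : R | 0 <= t]; pose F (t : R) x := q (x + t *: a) - t * q a.
have A0 : A !=set0 by exists 0; rewrite /A /=.
have Fb t x : A t -> F t x <= - q (- x).
  move=> t0; rewrite /F lerBlDr -qZ//.
  by have := qD (x + t *: a) (- x); rewrite addrAC subrr add0r; lra.
exists (fun x => sup [set F i x | i in A]); split.
- apply: (sup_family_superlinear A0 Fb).
  + move=> s t x y s0 t0; exists (s + t); first exact: addr_ge0.
    rewrite /F; have := qD (x + s *: a) (y + t *: a).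
    by rewrite addrACA -scalerDl mulrDl; lra.
  + move=> t c x t0 c0; exists (c * t); first by apply: mulr_ge0 => //; exact: ltW.
    have t0' : 0 <= t := t0.
    by rewrite /F -scalerA -scalerDr (qZ _ _ (ltW c0)) mulrBr mulrA.
  + by move=> t t0; rewrite /F add0r qZ// subrr.
- move=> x; apply: le_trans (sup_family_ge (F := F) (i := 0) Fb _ _); last by rewrite /A /=.
  by rewrite /F scale0r addr0 mul0r subr0.
- apply: le_trans (sup_family_ge (F := F) (i := 1) Fb _ _); last by rewrite /A /=.
  by rewrite /F scale1r addNr (superlinear0 qS) mul1r sub0r.
Qed.

(* A pointwise maximal superlinear functional cannot be refined, hence is odd. *)
Lemma superlinear_dominated_linear q : superlinear q ->
  exists f, linear_functional f /\ forall x, q x <= f x.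
Proof.
move=> qS.
pose T := {f : V -> R | superlinear f /\ forall x, q x <= f x}.
pose t0 : T := exist _ q (conj qS (fun x => lexx (q x))).
pose Le (f g : T) := `[< forall x, sval f x <= sval g x >].
have Lerefl (g : T) : Le g g by apply/asboolP.
have Letrans (h g k : T) : Le h g -> Le g k -> Le h k.
  by move=> /asboolP hg /asboolP gk; apply/asboolP => x; exact: le_trans (gk x).
have Lechain (A : set T) : total_on A Le -> exists t, forall s, A s -> Le s t.
  move=> totA; have [->|/set0P A0] := eqVneq A set0; first by exists t0.
  have Fb (g : T) x : A g -> sval g x <= - q (- x).
    move=> _; case: g => g [gS qg] /=; apply: le_trans (superlinear_leN x gS) _.
    by rewrite lerN2.
  have SS : superlinear (fun x => sup [set sval g x | g in A]).
    apply: (sup_family_superlinear A0 Fb).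
    - move=> g h x y Ag Ah.
      have [/asboolP gh|/asboolP hg] := totA g h Ag Ah.
        exists h => //; apply: le_trans (proj1 (proj1 (svalP h)) x y).
        by apply: lerD.
      exists g => //; apply: le_trans (proj1 (proj1 (svalP g)) x y).
      by apply: lerD.
    - move=> g c x Ag c0; exists g => //.
      by rewrite (proj2 (proj1 (svalP g)))// ltW.
    - by move=> g Ag; exact: superlinear0 (proj1 (svalP g)).
  have qSS x : q x <= sup [set sval g x | g in A].
    have [g Ag] := A0; apply: le_trans (proj2 (svalP g) x) _.
    exact: (sup_family_ge (F := fun g : T => sval g) Fb x Ag).
  pose t1 : T := exist (fun f => superlinear f /\ forall x, q x <= f x) _ (conj SS qSS).
  exists t1 => g Ag; apply/asboolP => x /=.
  exact: (sup_family_ge (F := fun g : T => sval g) Fb x Ag).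
have [[f [fS qf]] fmax] := ZL_preorder t0 Lerefl Letrans Lechain.
exists f; split=> //; apply: superlinear_odd_linear => // x.
(* Refining in the direction [- x] gives [- f (- x) <= f' x], while maximality of [f] gives
   [f' x <= f x]. *)
have [f' [f'S ff' f'N]] := superlinear_refine (- x) fS.
have qf' y : q y <= f' y by exact: le_trans (qf y) (ff' y).
pose t2 : T := exist (fun f => superlinear f /\ forall x, q x <= f x) _ (conj f'S qf').
have /asboolP/(_ x) /= := fmax t2 (introT (asboolP _) ff').
by apply: le_trans; rewrite opprK in f'N.
Qed.

(** After refining at [a], any linear [f] above [q'] satisfies [- q a <= f (- a) = - f a], so it
    touches [q] at [a]. *)
Lemma superlinear_attained q a : superlinear q ->
  exists f, [/\ linear_functional f, forall x, q x <= f x & f a = q a].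
Proof.
move=> qS; have [q' [q'S qq' q'N]] := superlinear_refine a qS.
have [f [fL q'f]] := superlinear_dominated_linear q'S.
exists f; split=> // [x|]; first exact: le_trans (qq' x) (q'f x).
apply/eqP; rewrite eq_le (le_trans (qq' a) (q'f a)) andbT.
rewrite -lerN2 -(linear_functionalN a fL); exact: le_trans q'N (q'f _).
Qed.

End Superlinear.

(** * Pointwise topology on functionals *)

Section WeakStar.
Variables (R : realType) (V : lmodType R).
Local Notation dual := {ptws V -> R}.
Implicit Types (q : V -> R) (x y : V) (D : set dual) (mu nu : dual).

Lemma ev_continuous x : continuous (fun mu : dual => mu x).
Proof. exact: (@proj_continuous V (fun=> R) x). Qed.

Lemma closed_eq_continuous (T : topologicalType) (f g : T -> R) :
  continuous f -> continuous g -> closed [set t | f t = g t].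
Proof.
move=> cf cg.
have -> : [set t | f t = g t] = (fun t => f t - g t) @^-1` [set r | r = 0].
  by apply/seteqP; split => t /=; [move=> ->; rewrite subrr|move/subr0_eq].
apply: preimage_closed; last exact: closed_eq.
by move=> t _; apply: continuousB; [exact: cf|exact: cg].
Qed.

Lemma closed_ge_continuous (T : topologicalType) (f : T -> R) c :
  continuous f -> closed [set t | c <= f t].
Proof.
move=> cf; apply: (@preimage_closed _ _ f [set r | c <= r]); last exact: closed_ge.
by move=> t _; exact: cf.
Qed.

(** For superlinear [q] this is its superdifferential at 0. *)
Definition dominating q : set dual :=
  [set mu | linear_functional mu /\ forall x, q x <= mu x].

Lemma dominating_closed q : closed (dominating q).
Proof.
have -> : dominating q =
    (\bigcap_(p : V * V) [set mu : dual | mu (p.1 + p.2) = mu p.1 + mu p.2]) `&`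
    ((\bigcap_(p : R * V) [set mu : dual | mu (p.1 *: p.2) = p.1 * mu p.2]) `&`
    (\bigcap_x [set mu : dual | q x <= mu x])).
  apply/seteqP; split => mu.
    by move=> [[muD muZ] qmu]; split=> [[x y] _|]; [|split=> [[c x] _|x _]] => /=.
  move=> [muD [muZ qmu]]; split=> [|x]; last exact: qmu.
  by split=> [x y|c x]; [exact: (muD (x, y))|exact: (muZ (c, x))].
apply: closedI; last apply: closedI; apply: closed_bigI => p _.
- apply: closed_eq_continuous; first exact: ev_continuous.
  by move=> mu; apply: continuousD; exact: ev_continuous.
- apply: closed_eq_continuous; first exact: ev_continuous.
  by move=> mu; apply: continuousM; [exact: cst_continuous|exact: ev_continuous].
- by apply: closed_ge_continuous; exact: ev_continuous.
Qed.

(** As in Banach-Alaoglu: linearity also gives [mu x <= - q (- x)], so these functionals form a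
    closed subset of a product of segments. *)
Lemma dominating_compact q : compact (dominating q).
Proof.
have cB := @tychonoff V (fun=> R) _ (fun x => @segment_compact R (q x) (- q (- x))).
apply: (subclosed_compact _ cB).
- exact: dominating_closed.
- move=> mu [muL qmu] x /=; rewrite in_itv /= qmu /=.
  by rewrite -lerN2 opprK -linear_functionalN.
Qed.

(** The sets of points of [D] agreeing with [mu] on a finite list form a filter base. A cluster
    point in [D] agrees with [mu] everywhere, because each coordinate condition is closed. *)
Lemma compact_agree D mu : compact D ->
  (forall s : seq V, exists2 nu, D nu & {in s, forall x, nu x = mu x}) -> D mu.
Proof.
move=> cD agree.
pose B (s : seq V) := D `&` [set nu | {in s, forall x, nu x = mu x}].
have FB : ProperFilter (filter_from setT B).
  apply: filter_from_proper; last by move=> s _; have [nu] := agree s; exists nu.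
  apply: filter_from_filter => [|s t _ _]; first by exists [::].
  exists (s ++ t) => // nu [Dnu numu].
  by split; split=> // x xst; apply: numu; rewrite mem_cat xst ?orbT.
have [|nu [Dnu clnu]] := cD _ FB; first by exists [::] => // nu [].
suff -> : mu = nu by [].
apply/esym/funext => x.
have cl : closed [set nu : dual | nu x = mu x].
  by apply: closed_eq_continuous; [exact: ev_continuous|exact: cst_continuous].
apply: cl => U nuU; apply: clnu => //; exists [:: x] => // ka [_ kamu].
by apply: kamu; rewrite mem_seq1.
Qed.

Definition distance2 (s : seq V) mu nu : R := \sum_(x <- s) (nu x - mu x) ^+ 2.

Lemma distance2_continuous s mu : continuous (distance2 s mu).
Proof.
elim: s => [|x s IH].
  have -> : distance2 [::] mu = cst 0 by apply/funext => nu; exact: big_nil.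
  by move=> nu; exact: cst_continuous.
have -> : distance2 (x :: s) mu =
    (fun nu : dual => (nu x - mu x) * (nu x - mu x) + distance2 s mu nu).
  by apply/funext => nu; rewrite /distance2 big_cons expr2.
move=> nu; apply: (@continuousD _ _ dual); last exact: IH.
have cx : {for nu, continuous (fun nu : dual => nu x - mu x)}.
  by apply: continuousB; [exact: ev_continuous|exact: cst_continuous].
exact: (continuousM cx cx).
Qed.

Lemma linear_functional_sum mu (s : seq V) (a : V -> R) : linear_functional mu ->
  mu (\sum_(x <- s) a x *: x) = \sum_(x <- s) a x * mu x.
Proof.
move=> [muD muZ]; elim: s => [|x s IH]; last by rewrite !big_cons muD muZ IH.
by rewrite !big_nil -(scale0r 0) muZ mul0r.
Qed.

(* The point of [D] whose values on [s] are nearest to those of [mu] yields, as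
   in the projection theorem, a vector on which [mu] would lie below [q]. *)
Lemma dominating_subset D q : D !=set0 -> compact D ->
  (forall mu nu (l : R), D mu -> D nu -> 0 <= l <= 1 ->
    D ((fun x => l * mu x + (1 - l) * nu x) : dual)) ->
  (forall mu, D mu -> linear_functional mu) ->
  (forall x, exists2 mu, D mu & mu x = q x) ->
  dominating q `<=` D.
Proof.
move=> D0 cD convD linD attD mu [muL qmu]; apply: compact_agree => // s.
have [|nu0] := compact_EVT_min (f := distance2 s mu) D0 cD.
  exact/continuous_subspaceT/distance2_continuous.
rewrite inE => Dnu0 nu0min; exists nu0 => //.
pose a x := nu0 x - mu x; pose z := \sum_(x <- s) a x *: x.
have [nu Dnu nuz] := attD z.
pose b x := nu x - mu x.
pose P := \sum_(x <- s) a x ^+ 2; pose Q := \sum_(x <- s) a x * b x.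
pose S := \sum_(x <- s) b x ^+ 2.
(* By linearity [Q] is [nu z - mu z], and [nu z = q z <= mu z]. *)
have Q0 : Q <= 0.
  rewrite /Q; under eq_bigr do rewrite mulrBr.
  rewrite sumrB -!linear_functional_sum//; last exact: linD.
  by rewrite subr_le0 -/z nuz; exact: qmu.
have P0 : 0 <= P by apply: sumr_ge0 => x _; exact: sqr_ge0.
have S0 : 0 <= S by apply: sumr_ge0 => x _; exact: sqr_ge0.
(* Moving from [nu0] towards [nu] stays in [D], so it cannot reduce the distance to [mu]. *)
have min_l l : 0 <= l <= 1 ->
    P <= l ^+ 2 * S + l * (1 - l) * Q *+ 2 + (1 - l) ^+ 2 * P.
  move=> l01; have := nu0min _ (mem_set (convD nu nu0 l Dnu Dnu0 l01)).
  rewrite /distance2 -/P => /le_trans; apply.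
  rewrite /P /Q /S -mulrnAr -sumrMnl !mulr_sumr -!big_split/=.
  by apply: ler_sum => x _; rewrite /a /b; lra.
have {}P0 : P = 0.
  apply/eqP; rewrite eq_le P0 andbT leNgt; apply/negP => Pgt0.
  have SP0 : 0 < S + P by lra.
  (* This weight minimises [l ^+ 2 * S + (1 - l) ^+ 2 * P]; the minimum is [(1 - l) * P], which is
     below [P]. *)
  pose l := P / (S + P).
  have l0 : 0 < l by rewrite divr_gt0.
  have l1 : l <= 1 by rewrite ler_pdivrMr// mul1r; lra.
  have lSP : l * (S + P) = P by rewrite mulfVK// gt_eqF.
  have := min_l l; rewrite (ltW l0) l1 => /(_ isT).
  have : l * (1 - l) * Q <= 0 by rewrite mulr_ge0_le0// mulr_ge0//; lra.
  have : l * P > 0 by exact: mulr_gt0.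
  have : l * (l * (S + P)) = l * P by rewrite lSP.
  nra.
move=> x xs; apply/subr0_eq/eqP; rewrite -sqrf_eq0.
move/eqP: P0; rewrite psumr_eq0 => [/allP/(_ x xs)//|y _]; exact: sqr_ge0.
Qed.

End WeakStar.

(** * Finitely additive probabilities on the integers *)

Section LinfModule.
Variable R : realType.
Implicit Types x y z : linf R.

Lemma linf_ext x y : (forall n, x n = y n) -> x = y.
Proof.
case: x y => [f fb] [g gb] /= /funext fg; subst g; congr Linf.
exact: Prop_irrelevance.
Qed.

(** The module structure makes the results on [lmodType] available for bounded sequences. Its
    operations are [ladd] and [lscale] themselves, so statements about them convert to [+] and
    [*:]. *)
HB.instance Definition _ := gen_eqMixin (linf R).
HB.instance Definition _ := gen_choiceMixin (linf R).

Let laddA : associative (@ladd R).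
Proof. by move=> x y z; apply: linf_ext => n /=; rewrite addrA. Qed.
Let laddC : commutative (@ladd R).
Proof. by move=> x y; apply: linf_ext => n /=; rewrite addrC. Qed.
Let ladd0 : left_id (lconst 0) (@ladd R).
Proof. by move=> x; apply: linf_ext => n /=; rewrite add0r. Qed.
Let laddN : left_inverse (lconst 0) (lscale (-1)) (@ladd R).
Proof. by move=> x; apply: linf_ext => n /=; rewrite mulN1r addNr. Qed.

HB.instance Definition _ :=
  GRing.isZmodule.Build (linf R) laddA laddC ladd0 laddN.

Let lscaleA (a b : R) x : lscale a (lscale b x) = lscale (a * b) x.
Proof. by apply: linf_ext => n /=; rewrite mulrA. Qed.
Let lscale1 : left_id 1 (@lscale R).
Proof. by move=> x; apply: linf_ext => n /=; rewrite mul1r. Qed.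
Let lscaleDr : right_distributive (@lscale R) +%R.
Proof. by move=> a x y; apply: linf_ext => n /=; rewrite mulrDr. Qed.
Let lscaleDl x : {morph (@lscale R)^~ x : a b / a + b}.
Proof. by move=> a b; apply: linf_ext => n /=; rewrite mulrDl. Qed.

HB.instance Definition _ :=
  GRing.Zmodule_isLmodule.Build R (linf R) lscaleA lscale1 lscaleDr lscaleDl.

Lemma linfD x y n : (x + y) n = x n + y n. Proof. by []. Qed.
Lemma linfZ (c : R) x n : (c *: x) n = c * x n. Proof. by []. Qed.
Lemma linfN x n : (- x) n = - x n.
Proof. by rewrite -[RHS]mulN1r. Qed.
Lemma linfB x y n : (x - y) n = x n - y n.
Proof. by rewrite linfD linfN. Qed.

End LinfModule.

(** * Positivity, invariance under finite permutations, and atoms *)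

Section FinitelyAdditive.
Variable R : realType.
Implicit Types (x y d : linf R) (mu : dualT R).

Lemma in_ba_linear mu : in_ba mu -> linear_functional mu.
Proof. by move=> [muD [muZ _]]; split=> // c x; exact: muZ. Qed.

Lemma lind_in (A : set nat) n : A n -> lind R A n = 1.
Proof. by move=> An /=; case: asboolP. Qed.

Lemma lind_out (A : set nat) n : ~ A n -> lind R A n = 0.
Proof. by move=> An /=; case: asboolP. Qed.

Lemma lind_setT : lind R setT = lconst 1.
Proof. by apply: linf_ext => n; rewrite lind_in. Qed.

Lemma lconst_scale (c : R) : lconst c = c *: lconst 1.
Proof. by apply: linf_ext => n; rewrite linfZ /= mulr1. Qed.

Lemma lconstD (a b : R) : lconst (a + b) = lconst a + lconst b.
Proof. by apply: linf_ext. Qed.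

Lemma lconstN (a : R) : lconst (- a) = - lconst a.
Proof. by apply: linf_ext => n; rewrite linfN. Qed.

Lemma Delta_lconst mu (c : R) : in_Delta mu -> mu (lconst c) = c.
Proof.
move=> [/in_ba_linear[_ muZ] [_ mu1]].
by rewrite lconst_scale muZ -lind_setT [X in c * X]mu1 mulr1.
Qed.

(* Subtracting [M / 2] on the set [x >= M / 2] halves the bound on [x] and only
   decreases [mu x]. *)
Lemma Delta_nonneg_approx mu (C : R) : in_Delta mu ->
  (forall x M, (forall n, `|x n| <= M) -> `|mu x| <= C * M) ->
  forall k (M : R) x, (forall n, 0 <= x n <= M) -> - (C * (M / 2 ^+ k)) <= mu x.
Proof.
move=> [/in_ba_linear[muD muZ] [mu0 _]] muC; elim=> [|k IH] M x x0M.
  rewrite expr0 divr1; suff : `|mu x| <= C * M by rewrite ler_norml => /andP[].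
  by apply: muC => n; have /andP[x0 xM] := x0M n; rewrite ger0_norm.
pose A := [set n | M / 2 <= x n]; pose y := x - (M / 2) *: lind R A.
have -> : x = y + (M / 2) *: lind R A by rewrite subrK.
have M0 : 0 <= M by have /andP[/le_trans/[apply]] := x0M 0.
rewrite muD muZ; apply: (@le_trans _ _ (mu y)); last first.
  by rewrite lerDl mulr_ge0 ?divr_ge0//; exact: mu0.
have -> : M / 2 ^+ k.+1 = M / 2 / 2 ^+ k by rewrite exprS invfM mulrA.
apply: IH => n; rewrite linfB linfZ; have := x0M n.
have [An|An] := pselect (A n); [rewrite (lind_in An)|rewrite (lind_out An)].
  by move: An; rewrite /A /=; lra.
by move/negP: An; rewrite -ltNge; lra.
Qed.

(** Positivity is given on indicators only; it extends to bounded sequences because the error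
    [C * (M / 2 ^+ k)] tends to 0. *)
Lemma Delta_nonneg mu x : in_Delta mu -> (forall n, 0 <= x n) -> 0 <= mu x.
Proof.
move=> muDelta x0; have [[_ [_ [C muC]]] _] := muDelta.
have [M xM] := lseq_bnd x.
have x0M n : 0 <= x n <= M by rewrite x0/= -[leLHS]ger0_norm.
have approx k := Delta_nonneg_approx muDelta muC k x0M.
rewrite leNgt; apply/negP => mux0.
have := upper_nthrootP (leqnn (Num.bound (C * M / - mu x))).
have N0 : 0 < - mu x by lra.
rewrite ltr_pdivrMr// => lt2k.
have := approx (Num.bound (C * M / - mu x)).
rewrite lerNl mulrA ler_pdivlMr ?exprn_gt0//; lra.
Qed.

(** Such an [x] is a combination of indicators of points, on which [mu] vanishes; the induction
    removes the last one. *)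
Lemma pa_finite_support mu x N :
  in_pa mu -> (forall n, (N <= n)%N -> x n = 0) -> mu x = 0.
Proof.
move=> [/in_ba_linear muL mu1]; have [muD muZ] := muL.
elim: N x => [|N IH] x x0.
  have -> : x = 0 by apply: linf_ext => n; rewrite x0.
  by rewrite -(scale0r 0) muZ mul0r.
have -> : x = (x - x N *: lind R [set N]) + x N *: lind R [set N] by rewrite subrK.
rewrite muD muZ [X in _ + _ * X]mu1 mulr0 addr0; apply: IH => n Nn.
rewrite linfB linfZ; have [->|nN] := eqVneq n N; first by rewrite lind_in// mulr1 subrr.
rewrite lind_out ?mulr0 ?subr0; last by apply/eqP.
by apply: x0; rewrite ltn_neqAle eq_sym nN.
Qed.

(** The difference [lperm s d - d] has finite support. *)
Lemma pa_finite_perm mu d s :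
  in_pa mu -> finite_perm s -> mu (lperm s d) = mu d.
Proof.
move=> mupa [_ sfin]; have [/in_ba_linear muL _] := mupa; have [muD _] := muL.
apply/subr0_eq; rewrite -(linear_functionalN d muL) -muD.
have /finite_seqP[t st] := sfin.
(* The successor puts every remaining [n] strictly beyond all moved points. *)
apply: (pa_finite_support (N := (\max_(i <- t) i).+1) mupa) => n tn.
rewrite linfB /=; suff -> : s n = n by rewrite subrr.
apply: contrapT => sn.
have : [set` t] n by rewrite -st.
by move=> /= nt; have := leq_bigmax_seq (P := xpredT) (F := id) n nt isT; rewrite leqNgt tn.
Qed.

Definition transpose (i j n : nat) : nat :=
  if n == i then j else if n == j then i else n.

Lemma transpose_finite_perm i j : finite_perm (transpose i j).
Proof.
split.
  have tK : cancel (transpose i j) (transpose i j).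
    by move=> n; rewrite /transpose; do !case: eqP => //; congruence.
  by exists (transpose i j).
apply: (@sub_finite_set _ _ [set i; j]); last exact: finite_set2.
move=> n /=; rewrite /transpose.
by case: eqP => [|_]; [left|case: eqP => [|_]; [right|]].
Qed.

Lemma lperm_transpose_lind i j :
  lperm (transpose i j) (lind R [set i]) = lind R [set j].
Proof.
apply: linf_ext => n /=; congr (if _ then _ else _).
apply: asbool_equiv_eq; rewrite /transpose /=.
by split; do !case: eqP => //; congruence.
Qed.

(** All atoms have one common mass [c], and the first [N] points have mass [N%:R * c <= 1] for every
    [N]. *)
Lemma Delta_constant_atoms_pa mu : in_Delta mu ->
  (forall i j, setfun mu [set i] <= setfun mu [set j]) -> in_pa mu.
Proof.
move=> muDelta atoms; have [muba [mu0 _]] := muDelta; split=> // i.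
have [muD muZ] := in_ba_linear muba.
pose c := setfun mu [set i].
have head N : mu (lind R [set n | (n < N)%N]) = N%:R * c.
  elim: N => [|N IH].
    have -> : lind R [set n | (n < 0)%N] = 0 *: 0.
      by apply: linf_ext => n; rewrite lind_out// linfZ mul0r.
    by rewrite muZ !mul0r.
  have -> : lind R [set n | (n < N.+1)%N] =
      lind R [set n | (n < N)%N] + lind R [set N].
    apply: linf_ext => n; rewrite linfD /=.
    by do 3 case: asboolP => /=; rewrite ?ltnS ?addr0 ?add0r//; lia.
  rewrite muD IH -natr1 mulrDl mul1r; congr (_ + _).
  by apply/eqP; rewrite eq_le !atoms.
apply/eqP; rewrite eq_le mu0 andbT leNgt; apply/negP => c0.
have le1 N : N%:R * c <= 1.
  rewrite -head -(Delta_lconst 1 muDelta) -subr_ge0.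
  rewrite -(linear_functionalN _ (in_ba_linear muba)) -muD.
  apply: Delta_nonneg => // n; rewrite linfB /=.
  by case: ifP => _; rewrite ?subrr ?subr0.
have := archi_boundP (ltW (divr_gt0 ltr01 c0)).
by rewrite ltr_pdivrMr// ltNge le1.
Qed.

End FinitelyAdditive.

(** * Preferences represented by a minimum *)

Section MinRepresentation.
Variables (R : realType) (D : set (dualT R)) (I : linf R -> R).
Hypothesis D_Delta : forall mu, D mu -> in_Delta mu.
Hypothesis DI : is_min_rep D I.
Implicit Types x y : linf R.

Let muL mu (Dmu : D mu) : linear_functional mu := in_ba_linear (proj1 (D_Delta Dmu)).

(** Each inequality is read off at a functional attaining the minimum on its larger side. *)
Lemma min_rep_superlinear : superlinear I.
Proof.
split=> [x y|c x c0].
  have [[mu Dmu <-] _] := DI (x + y); rewrite (muL Dmu).1.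
  by apply: lerD; exact: (DI _).2.
apply/eqP; rewrite eq_le; apply/andP; split.
  by have [[mu Dmu <-] _] := DI x; rewrite -(muL Dmu).2; exact: (DI _).2.
have [[mu Dmu <-] _] := DI (c *: x); rewrite (muL Dmu).2.
by apply: ler_wpM2l => //; exact: (DI _).2.
Qed.

Lemma min_rep_lconst c : I (lconst c) = c.
Proof. by have [[mu Dmu <-] _] := DI (lconst c); exact: Delta_lconst (D_Delta Dmu). Qed.

Lemma min_rep_translate x c : I (x + lconst c) = I x + c.
Proof.
have [Isup _] := min_rep_superlinear.
apply/eqP; rewrite eq_le; apply/andP; split.
  have := Isup (x + lconst c) (lconst (- c)).
  rewrite !min_rep_lconst lconstN addrK; lra.
by have := Isup x (lconst c); rewrite min_rep_lconst.
Qed.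

Lemma min_rep_mono x y : (forall n, y n <= x n) -> I y <= I x.
Proof.
move=> yx; have [[mu Dmu <-] _] := DI x; apply: le_trans ((DI y).2 _ Dmu) _.
rewrite -subr_ge0 -(linear_functionalN _ (muL Dmu)) -(muL Dmu).1.
by apply: Delta_nonneg (D_Delta Dmu) _ => n; rewrite linfB subr_ge0.
Qed.

Lemma min_rep_le_dist x y c : (forall n, y n <= x n + c) -> I y <= I x + c.
Proof. by move=> yx; rewrite -min_rep_translate; exact: min_rep_mono. Qed.

(** Changing the weight from [a] to [b] moves every coordinate by at most [|a - b| * K], so the map
    is Lipschitz. *)
Lemma min_rep_mix_continuous x z : continuous (fun a : R => I (mix a x z)).
Proof.
have [M xM] := lseq_bnd x; have [N zN] := lseq_bnd z.
(* The added 1 keeps [K] positive, so that [e / K] is a valid radius. *)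
pose K := M + N + 1.
have K0 : 0 < K.
  rewrite /K; have := le_trans (normr_ge0 _) (xM 0).
  by have := le_trans (normr_ge0 _) (zN 0); lra.
have lip a b : I (mix a x z) <= I (mix b x z) + `|a - b| * K.
  apply: min_rep_le_dist => n /=; rewrite -lerBlDl.
  have -> : a * x n + (1 - a) * z n - (b * x n + (1 - b) * z n) =
    (a - b) * (x n - z n) by ring.
  apply: le_trans (ler_norm _) _; rewrite normrM ler_wpM2l//.
  by apply: le_trans (ler_normB _ _) _; have := xM n; have := zN n; rewrite /K; lra.
move=> a; apply/cvgrPdist_lt => e e0; near=> b.
have ab : `|a - b| * K < e.
  rewrite -ltr_pdivlMr//; near: b.
  by apply: (@cvgr_dist_lt _ _ _ (nbhs a) _ id a) => //; exact: divr_gt0.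
by have := lip a b; have := lip b a; rewrite (distrC b) ltr_norml; lra.
Unshelve. all: by end_near. Qed.

Variable pref : linf R -> linf R -> Prop.
Hypothesis prefI : const_equiv pref I.

Let prefE x y : pref x y <-> I y <= I x := proj2 prefI x y.

Lemma min_rep_weak_order : weak_order pref.
Proof.
split=> [x y|x y z /prefE yx /prefE zy]; last by apply/prefE; exact: le_trans yx.
by case/orP: (le_total (I y) (I x)) => /prefE; [left|right].
Qed.

Lemma min_rep_monotonicity : monotonicity pref.
Proof.
split=> [x y xy|]; first by apply/prefE; exact: min_rep_mono.
by split=> [|/prefE]; rewrite ?prefE !min_rep_lconst ?ler10.
Qed.

Lemma min_rep_continuity : continuity pref.
Proof.
move=> x y z _ _.
have cI : continuous (fun a : R => I (mix a x z)) by exact: min_rep_mix_continuous.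
have c01 : closed [set a : R | 0 <= a <= 1].
  have -> : [set a : R | 0 <= a <= 1] = [set` `[0, 1]%R].
    by apply/seteqP; split=> a /=; rewrite in_itv.
  exact: interval_closed.
(* Here [P] is [pref] or its converse, so one argument serves both sets. *)
have half (P : linf R -> linf R -> Prop) (C : set R) : closed C ->
    (forall a, P (mix a x z) y <-> C (I (mix a x z))) ->
    closed [set a : R | 0 <= a <= 1 /\ P (mix a x z) y].
  move=> cC PC; have -> : [set a : R | 0 <= a <= 1 /\ P (mix a x z) y] =
      [set a | 0 <= a <= 1] `&` (fun a => I (mix a x z)) @^-1` C.
    by apply/seteqP; split=> a [a01 /PC].
  apply: closedI => //; apply: preimage_closed => // a _; exact: cI.
split.
  by apply: (half pref [set r | I y <= r]) => // a; exact: prefE.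
by apply: (half (fun u v => pref v u) [set r | r <= I y]) => // a; exact: prefE.
Qed.

Lemma min_rep_ICRP : ICRP pref.
Proof.
move=> x y t /prefE yx; apply/prefE.
by rewrite [I (ladd y _)]min_rep_translate [I (ladd x _)]min_rep_translate lerD2r.
Qed.

Lemma min_rep_convexity : convexity pref.
Proof.
move=> x y t l /andP[l0 l1] /prefE + /prefE; rewrite min_rep_lconst => tx ty.
apply/prefE; rewrite min_rep_lconst; have [ID IZ] := min_rep_superlinear.
apply: le_trans (ID (l *: x) ((1 - l) *: y)); rewrite !IZ ?subr_ge0//; nra.
Qed.

Lemma min_rep_ISU : ISU pref.
Proof.
move=> x y a a0 /prefE yx; apply/prefE; have [_ IZ] := min_rep_superlinear.
by rewrite [I (lscale a y)]IZ// [I (lscale a x)]IZ// ler_wpM2l.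
Qed.

(** A [mu] attaining the minimum at the permuted sum takes the same value at [x + d], where it is at
    least [I (x + d) >= I x]. *)
Lemma min_rep_IFPIS : (forall mu, D mu -> in_pa mu) -> IFPIS pref.
Proof.
move=> D_pa s sperm x d /prefE xd; apply/prefE.
have [[mu Dmu <-] _] := DI (ladd x (lperm s d)); apply: le_trans xd _.
rewrite [leRHS](muL Dmu).1 (pa_finite_perm d (D_pa _ Dmu) sperm) -(muL Dmu).1.
exact: (DI _).2.
Qed.

End MinRepresentation.

(** Applying [I] to both sides of the indifference between [x] and [lconst (J x)] gives
    [I x = J x]. *)
Lemma const_equiv_unique (R : realType) (pref : linf R -> linf R -> Prop)
    (I J : linf R -> R) : (forall c, I (lconst c) = c) ->
  const_equiv pref I -> const_equiv pref J -> J = I.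
Proof.
move=> Ic [_ prefI] [J_eq _]; apply/funext => x; have [/prefI xJ /prefI Jx] := J_eq x.
by apply/eqP; rewrite eq_le; move: xJ Jx; rewrite Ic => -> ->.
Qed.

(** * From the axioms to the representation *)

Section Representation.
Variables (R : realType) (pref : linf R -> linf R -> Prop).
Hypotheses (pref_wo : weak_order pref) (pref_mono : monotonicity pref).
Hypotheses (pref_cont : continuity pref) (pref_ICRP : ICRP pref).
Hypotheses (pref_conv : convexity pref) (pref_ISU : ISU pref).
Hypothesis pref_IFPIS : IFPIS pref.
Implicit Types (x y : linf R) (a b c : R).

(** If [a < b], translating by [- a] and scaling by [(b - a)^-1] would turn a preference for [a]
    over [b] into one for 0 over 1. *)
Lemma pref_lconst a b : pref (lconst a) (lconst b) <-> b <= a.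
Proof.
split=> [|ba]; last by apply: pref_mono.1 => n.
rewrite leNgt => ab; apply/negP => lt_ab; apply: pref_mono.2.2.
have := pref_ICRP (- a) ab.
rewrite -[ladd _ _]lconstD -[ladd (lconst b) _]lconstD subrr => ba0.
have c0 : 0 <= (b - a)^-1 by rewrite invr_ge0 subr_ge0 ltW.
have := pref_ISU c0 ba0.
have -> : lscale (b - a)^-1 (lconst (b - a)) = lconst 1.
  by apply: linf_ext => n /=; rewrite mulVf// subr_eq0 gt_eqF.
by have -> : lscale (b - a)^-1 (lconst 0) = lconst 0
  by apply: linf_ext => n /=; rewrite mulr0.
Qed.

(* The mixtures of two bounding constants weakly above [x] and those weakly below
   are closed and cover the connected segment, so they meet. *)
Lemma exists_constant_equivalent x : exists c, indiff pref x (lconst c).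
Proof.
have [M xM] := lseq_bnd x.
have Mx : pref (lconst M) x.
  by apply: pref_mono.1 => n /=; exact: le_trans (ler_norm _) (xM n).
have xN : pref x (lconst (- M)).
  by apply: pref_mono.1 => n /=; have := xM n; rewrite ler_norml => /andP[].
have [clA clB] := pref_cont Mx xN.
set A := (X in closed X) in clA; set B := (X in closed X) in clB.
have mixE a : mix a (lconst M) (lconst (- M)) = lconst (a * M + (1 - a) * - M).
  by apply: linf_ext.
apply: contrapT => nox.
have disj a : A a -> ~ B a.
  move=> [_ Aa] [_ Ba]; apply: nox; exists (a * M + (1 - a) * - M).
  by rewrite -mixE; split.
have cover a : 0 <= a <= 1 -> A a \/ B a.
  by move=> a01; case: (pref_wo.1 (mix a (lconst M) (lconst (- M))) x) => ?;
    [left|right].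
(* Without a constant equivalent, [A] is closed and is also the relative complement of the closed
   set [B]; being nonempty, it is the whole segment. *)
have AE : A = `[0, 1]%classic.
  apply: (@segment_connected R 0 1).
  - exists 1; split; rewrite ?ler01 ?lexx// mixE subrr mul0r addr0 mul1r//.
  - exists (~` B); first exact: closed_openC.
    apply/seteqP; split=> [a Aa|a [/= a01 nBa]].
      by split; [rewrite /= in_itv /=; case: Aa|exact: disj].
    by rewrite in_itv /= in a01; case: (cover a a01).
  - exists A => //; apply/seteqP; split=> [a Aa|a []//].
    by split=> //; rewrite /= in_itv /=; case: Aa.
(* At weight 0 the mixture is [lconst (- M)], which lies weakly below [x], so 0 is also in [B]. *)
have A0 : A 0 by rewrite AE /= in_itv /= lexx ler01.
apply: (disj 0 A0); split; rewrite ?lexx ?ler01// mixE.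
by rewrite mul0r add0r subr0 mul1r.
Qed.

(** * Superlinearity of the constant equivalent and the functionals above it *)

Section ConstantEquivalent.
Variable I : linf R -> R.
Hypothesis I_indiff : forall x, indiff pref x (lconst (I x)).

Lemma indiff_const_equiv : const_equiv pref I.
Proof.
have [_ trans] := pref_wo.
split=> // x y; have [xI Ix] := I_indiff x; have [yI Iy] := I_indiff y.
split=> [xy|/pref_lconst Ixy].
  by apply/pref_lconst; apply: (trans _ _ _ Ix); apply: (trans _ _ _ xy).
by apply: (trans _ _ _ xI); apply: (trans _ _ _ Ixy).
Qed.

Let prefE x y : pref x y <-> I y <= I x := proj2 indiff_const_equiv x y.

Lemma const_equiv_lconst c : I (lconst c) = c.
Proof.
have [/pref_lconst cI /pref_lconst Ic] := I_indiff (lconst c).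
by apply/eqP; rewrite eq_le cI Ic.
Qed.

Lemma const_equiv_translate x c : I (x + lconst c) = I x + c.
Proof.
have [xI Ix] := I_indiff x.
have /prefE := pref_ICRP c xI; have /prefE := pref_ICRP c Ix.
rewrite -[ladd (lconst _) _]lconstD const_equiv_lconst => h1 h2.
by apply/eqP; rewrite eq_le h1 h2.
Qed.

(** ISU gives homogeneity. Translating [x] and [y] so that both become indifferent to 0, convexity
    at weight one half gives superadditivity. *)
Lemma const_equiv_superlinear : superlinear I.
Proof.
have IZ c x : 0 <= c -> I (c *: x) = c * I x.
  move=> c0; have [xI Ix] := I_indiff x.
  have /prefE := pref_ISU c0 xI; have /prefE := pref_ISU c0 Ix.
  rewrite -[lscale c (lconst _)]/(c *: lconst (I x)).
  have -> : c *: lconst (I x) = lconst (c * I x) by apply: linf_ext.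
  by rewrite const_equiv_lconst => h1 h2; apply/eqP; rewrite eq_le h1 h2.
split=> // x y.
have nonneg z : pref (z + lconst (- I z)) (lconst 0).
  by apply/prefE; rewrite const_equiv_translate const_equiv_lconst subrr.
have half01 : 0 <= (2^-1 : R) <= 1 by rewrite invr_ge0 invf_le1 ?ler1n ?ler0n.
have /prefE := pref_conv half01 (nonneg x) (nonneg y).
rewrite const_equiv_lconst.
have -> : mix 2^-1 (x + lconst (- I x)) (y + lconst (- I y)) =
    2^-1 *: (x + y + lconst (- (I x + I y))).
  by apply: linf_ext => n /=; lra.
by rewrite IZ ?invr_ge0// const_equiv_translate; lra.
Qed.

Lemma const_equiv_ge x c : (forall n, c <= x n) -> c <= I x.
Proof.
move=> cx; rewrite -{1}(const_equiv_lconst c); apply/prefE.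
by apply: pref_mono.1.
Qed.

(** Since [I] is at least any lower bound of its argument, domination at [x] and [- x] bounds the
    norm by 1; domination at the constants 1 and -1 fixes the total mass. *)
Lemma dominating_Delta mu : dominating I mu -> in_Delta mu.
Proof.
move=> [muL Imu]; have [muD muZ] := muL; split; last split.
- split=> //; split=> //; exists 1 => x M xM; rewrite mul1r ler_norml.
  apply/andP; split.
    apply: le_trans (Imu x); apply: const_equiv_ge => n.
    by have := xM n; rewrite ler_norml => /andP[].
  rewrite -lerN2 -(linear_functionalN x muL); apply: le_trans (Imu _).
  apply: const_equiv_ge => n; rewrite linfN lerN2.
  exact: le_trans (ler_norm _) (xM n).
- move=> A; apply: le_trans (Imu _); apply: const_equiv_ge => n /=.
  by case: ifP.
- rewrite /setfun lind_setT; apply/eqP; rewrite eq_le; apply/andP; split.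
    rewrite -lerN2 -(linear_functionalN (lconst 1) muL) -lconstN.
    by rewrite -[leLHS](const_equiv_lconst (- 1)).
  by rewrite -[leLHS](const_equiv_lconst 1).
Qed.

Lemma dominating_pa mu : dominating I mu -> in_pa mu.
Proof.
move=> domI; have [muL Imu] := domI.
apply: (Delta_constant_atoms_pa (dominating_Delta domI)) => i j.
pose e k := lind R [set k].
(* With this choice [- e i + d] is the constant equivalent of [- e i]. *)
pose d := e i + lconst (I (- e i)).
have xd : pref (ladd (- e i) d) (- e i).
  apply/prefE; rewrite [I (ladd _ _)](_ : _ = I (lconst (I (- e i)))).
    by rewrite const_equiv_lconst.
  by congr I; exact: addKr.
(* The transposition turns [e i] into [e j] and fixes the constant, which then cancels to leave
   [0 <= I (e j - e i)]. *)
have /prefE := pref_IFPIS (transpose_finite_perm i j) xd.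
have -> : ladd (- e i) (lperm (transpose i j) d) =
    (e j - e i) + lconst (I (- e i)).
  rewrite /e -(lperm_transpose_lind R i j).
  by apply: linf_ext => n /=; ring.
rewrite const_equiv_translate lerDr => Ige0.
rewrite -subr_ge0 /setfun -(linear_functionalN (e i) muL) -muL.1.
exact: le_trans Ige0 (Imu _).
Qed.

Lemma dominating_min_rep : is_min_rep (dominating I) I.
Proof.
move=> x; split=> [|mu [_]//].
have [mu [muL Imu mux]] := superlinear_attained x const_equiv_superlinear.
by exists mu.
Qed.

End ConstantEquivalent.
End Representation.

(** * Equivalence of axioms and representation, with uniqueness of the set *)

Theorem theorem6 (R : realType) (pref : linf R -> linf R -> Prop) :
  (weak_order pref /\ monotonicity pref /\ continuity pref /\ ICRP pref /\
   convexity pref /\ ISU pref /\ IFPIS pref)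
  <->
  (exists D : set (dualT R),
     let good (D : set (dualT R)) :=
       [/\ D !=set0, convex_dual D, compact D,
           (forall mu, D mu -> in_pa mu /\ in_Delta mu) &
           exists I : linf R -> R,
             [/\ is_min_rep D I, const_equiv pref I &
                 forall J, const_equiv pref J -> J = I]] in
     good D /\ forall D', good D' -> D' = D).
Proof.
split=> [[wo [mono [cont [icrp [conv [isu ifpis]]]]]]|[D [[_ _ _ DpD [I [DI prefI _]]] _]]].
  have [I I_indiff] := choice (exists_constant_equivalent wo mono cont).
  have prefI := indiff_const_equiv wo mono icrp isu I_indiff.
  have Ic := const_equiv_lconst mono icrp isu I_indiff.
  have DI := dominating_min_rep wo mono icrp conv isu I_indiff.
  have uniqI J : const_equiv pref J -> J = I by exact: const_equiv_unique.
  exists (dominating I); split.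
    split.
    - by have [[mu Dmu _] _] := DI (lconst 0); exists mu.
    - move=> mu nu l [[muD muZ] Imu] [[nuD nuZ] Inu] /andP[l0 l1].
      split; first by split=> [x y|c x]; rewrite ?muD ?nuD ?muZ ?nuZ; ring.
      by move=> x; have := Imu x; have := Inu x; nra.
    - exact: dominating_compact.
    - move=> mu Dmu; split; first exact: (dominating_pa wo mono icrp isu ifpis).
      exact: (dominating_Delta wo mono icrp isu I_indiff).
    - by exists I.
  (* A competing set has the same minimum [I] by uniqueness of constant equivalents; one inclusion
     is then immediate and the other is the separation argument. *)
  move=> D [D0 convD cD DpD [J [DJ /uniqI JI _]]]; rewrite {}JI in DJ.
  have linD mu : D mu -> linear_functional mu.
    by move=> /DpD[_ [/in_ba_linear]].
  apply/seteqP; split=> [mu Dmu|].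
    by split=> [|x]; [exact: linD|exact: (DJ x).2].
  by apply: dominating_subset => // x; exact: (DJ x).1.
have D_Delta mu : D mu -> in_Delta mu by move=> /DpD[].
have D_pa mu : D mu -> in_pa mu by move=> /DpD[].
split; first exact: (min_rep_weak_order prefI).
split; first exact: (min_rep_monotonicity D_Delta DI prefI).
split; first exact: (min_rep_continuity D_Delta DI prefI).
split; first exact: (min_rep_ICRP D_Delta DI prefI).
split; first exact: (min_rep_convexity D_Delta DI prefI).
split; first exact: (min_rep_ISU D_Delta DI prefI).
exact: (min_rep_IFPIS D_Delta DI prefI D_pa).
Qed.
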